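(* Let $p$ be an odd prime and let $0<\alpha\le1$ be fixed. There exist functions $a(n),c(n)$, depending only on $p$ and $\alpha$ and tending to $0$ as $n\to\infty$, such that the following holds. Let $f:\mathbb{F}_{p^n}\to[0,1]$ satisfy $\mathbb{E}(f)\ge\alpha$ and suppose $\Lambda_3(f)$ is minimal among all functions $f':\mathbb{F}_{p^n}\to[0,1]$ with $\mathbb{E}(f')\ge\alpha$. Then there exist a subgroup (subspace) $W\le\mathbb{F}_{p^n}$ with $\dim W\ge n-a(n)\,n$ and a function $h:\mathbb{F}_{p^n}\to\{0,1\}$ which is constant on cosets of $W$ (i.e. $h(x)=h(x+w)$ for all $x\in\mathbb{F}_{p^n}$, $w\in W$) such that $$\mathbb{E}(|f(m)-h(m)|)\le c(n).$$ (In the paper's notation: $\dim W=n-o(n)$ and $\mathbb{E}(|f-h|)=o(1)$.)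
   Context: $\mathbb{F}_{p^n}$ is regarded as an $n$-dimensional vector space over $\mathbb{F}_p$. For $g:\mathbb{F}_{p^n}\to\mathbb{C}$, $\mathbb{E}(g)=p^{-n}\sum_{m\in\mathbb{F}_{p^n}} g(m)$. For $f:\mathbb{F}_{p^n}\to[0,1]$, $\Lambda_3(f)=p^{-2n}\sum_{m,d\in\mathbb{F}_{p^n}} f(m)f(m+d)f(m+2d)$. *)

(* Defs.v *)
From HB Require Import structures.
From mathcomp Require Import all_boot all_order all_algebra.
From mathcomp Require Import all_classical all_reals all_analysis.
Set Implicit Arguments. Unset Strict Implicit. Unset Printing Implicit Defensive.
Import Order.TTheory GRing.Theory Num.Theory.
Local Open Scope ring_scope.

(* F_{p^n} viewed as the n-dimensional F_p-vector space 'rV['F_p]_n. *)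
Notation Fpn p n := 'rV['F_p]_n.

Definition Ex (R : realType) (p n : nat) (g : Fpn p n -> R) : R :=
  (p%:R ^+ n)^-1 * \sum_(m : Fpn p n) g m.

Definition Lambda3 (R : realType) (p n : nat) (f : Fpn p n -> R) : R :=
  (p%:R ^+ (2 * n))^-1 *
  \sum_(m : Fpn p n) \sum_(d : Fpn p n) f m * f (m + d) * f (m + d *+ 2).

Definition unit_valued (R : realType) (p n : nat) (f : Fpn p n -> R) : Prop :=
  forall x, 0 <= f x <= 1.

(* Main.v *)
(** Write q = #|F|.  If W is the common kernel of the boundedly many
    linear forms along which f is biased, and E(f|W) is the average of f over
    cosets of W, then k = f - E(f|W) has small sums on all hyperplanes, so
    Lambda_3(f) = Lambda_3(E(f|W)) + Lambda_3(k) with Lambda_3(k) small.  On the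
    other hand, put u = min(E(f|W), 1 - E(f|W)) and let l be a linear form that
    is nonzero on W.  Then f' = E(f|W) + u * (1/q - 1_{l = 0}) is a competitor
    with the same mean, and
    Lambda_3(f') = Lambda_3(E(f|W)) - (1 - 1/q) q^-2 Lambda_3(u).
    Minimality of f makes Lambda_3(u) small, hence E(u) is small by Roth's
    theorem (in Varnavides' form, proved by density increment), and
    E(u) = E|f - h| for h the rounding of E(f|W) to {0,1}.

    Characters are avoided: the identity
    q * #{l : l(v) = 0} = q^n (1 + (q - 1) 1_{v = 0}) expresses both the l^2
    norm and the progression count of a mean-zero function through its sums
    over the hyperplanes l = t. *)

Require Import Defs.
From HB Require Import structures.
From mathcomp Require Import all_boot all_order all_algebra ring lra.
From mathcomp Require Import all_classical all_reals all_analysis.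
Set Implicit Arguments. Unset Strict Implicit. Unset Printing Implicit Defensive.
Import Order.TTheory GRing.Theory Num.Theory.
Import numFieldNormedType.Exports.
Local Open Scope ring_scope.

(** * Linear forms and hyperplane sums *)

Section Counting.
Context {R : realFieldType} {F : finFieldType} {n : nat}.
Implicit Types (a b c g u : 'rV[F]_n -> R) (x y v w : 'rV[F]_n) (xi : 'cV[F]_n).

(** The unnormalised progression count, parametrised by the first and middle terms, so that the
    effect of translating either one on the third is explicit. *)
Definition ap3 a b c : R := \sum_x \sum_y a x * b y * c (y *+ 2 - x).
Definition dot xi x : F := (x *m xi) 0 0.
(** For fixed [xi] these sums carry the same information as the Fourier coefficients of [g] at the
    multiples of [xi]. *)
Definition slice g xi (t : F) : R := \sum_(x | dot xi x == t) g x.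

Let q : R := #|F|%:R.
Let M : R := #|{: 'rV[F]_n}|%:R.

Lemma dotD xi x y : dot xi (x + y) = dot xi x + dot xi y.
Proof. by rewrite /dot mulmxDl mxE. Qed.
Lemma dotN xi x : dot xi (- x) = - dot xi x.
Proof. by rewrite /dot mulNmx mxE. Qed.
Lemma dotZ xi s x : dot xi (s *: x) = s * dot xi x.
Proof. by rewrite /dot -scalemxAl mxE. Qed.
Lemma dotMn xi x : dot xi (x *+ 2) = dot xi x *+ 2.
Proof. by rewrite !mulr2n dotD. Qed.

Lemma dotDl xi eta x : dot (xi + eta) x = dot xi x + dot eta x.
Proof. by rewrite /dot mulmxDr mxE. Qed.
Lemma dotZl xi s x : dot (s *: xi) x = s * dot xi x.
Proof. by rewrite /dot -scalemxAr mxE. Qed.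

Lemma card_gt0 : 0 < q.
Proof. by rewrite ltr0n; apply/card_gt0P; exists 0. Qed.
Lemma card_gt1 : 1 < q.
Proof. by rewrite ltr1n card_finNzRing_gt1. Qed.

Lemma exists_dot1 xi : xi != 0 -> exists v, dot xi v = 1.
Proof.
move=> xi0; have [i xii] : exists i, xi i 0 != 0.
  apply/existsP; apply: contraNT xi0 => /existsPn xi0.
  by apply/eqP/colP => i; rewrite mxE; apply/eqP; rewrite -[_ == _]negbK xi0.
exists ((xi i 0)^-1 *: delta_mx 0 i).
by rewrite dotZ /dot -rowE mxE mulVf.
Qed.

Lemma exists_dual1 v : v != 0 -> exists xi, dot xi v = 1.
Proof.
move=> v0; have [i vi] : exists i, v 0 i != 0.
  apply/existsP; apply: contraNT v0 => /existsPn v0.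
  by apply/eqP/rowP => i; rewrite mxE; apply/eqP; rewrite -[_ == _]negbK v0.
exists ((v 0 i)^-1 *: delta_mx i 0).
by rewrite /dot -scalemxAr -colE !mxE mulVf.
Qed.

Lemma sum_avg (Z : finZmodType) (e : F -> Z) (K : Z -> R) :
  q * \sum_x K x = \sum_x \sum_s K (x + e s).
Proof.
rewrite exchange_big /= [RHS](eq_bigr (fun _ => \sum_x K x)) => [|s _].
  by rewrite sumr_const -[RHS]mulr_natl.
by rewrite [RHS](reindex_inj (addIr (e s))).
Qed.

Lemma sum_avg2 v (K : 'rV[F]_n -> 'rV[F]_n -> R) :
  q ^+ 2 * \sum_x \sum_y K x y =
  \sum_x \sum_y \sum_s \sum_r K (x + s *: v) (y + r *: v).
Proof.
rewrite expr2 -mulrA (sum_avg (fun s => s *: v)) mulr_sumr; apply: eq_bigr => x _.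
rewrite mulr_sumr exchange_big; apply: eq_bigr => s _ /=.
by rewrite (sum_avg (fun s => s *: v)).
Qed.

(** If [v] is nonzero, pick a form [xi1] with value 1 at [v]: along each line [xi + s *: xi1] the
    value at [v] vanishes for exactly one [s]. *)
Lemma sum_forms v :
  q * \sum_xi (dot xi v == 0)%:R = M * (1 + (q - 1) * (v == 0)%:R).
Proof.
have McV : M = #|{: 'cV[F]_n}|%:R by rewrite /M !card_mx mul1n muln1.
have [->|v0] := eqVneq v 0.
  rewrite mulr1 addrC subrK mulrC McV; congr (_ * _).
  rewrite (eq_bigr (fun _ => 1)) ?sumr_const // => xi _.
  by rewrite /dot mul0mx mxE eqxx.
rewrite mulr0 addr0 mulr1 McV.
have [xi1 xi1v] := exists_dual1 v0.
rewrite (sum_avg (fun s => s *: xi1)) -[RHS]sumr_const; apply: eq_bigr => xi _.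
rewrite (bigD1 (- dot xi v)) //= big1 ?addr0.
  by rewrite dotDl dotZl xi1v mulr1 subrr eqxx.
move=> s sN; rewrite dotDl dotZl xi1v mulr1.
by rewrite addrC addr_eq0 (negPf sN).
Qed.

Lemma sum_slice g xi (k : F -> R) : 
  \sum_t slice g xi t * k t = \sum_x g x * k (dot xi x).
Proof.
rewrite [RHS](partition_big (dot xi) xpredT) //=; apply: eq_bigr => t _.
by rewrite mulr_suml; apply: eq_bigr => x /eqP ->.
Qed.

Lemma sum_slice1 g xi : \sum_t slice g xi t = \sum_x g x.
Proof.
rewrite -(eq_bigr _ (fun t _ => mulr1 (slice g xi t))) (sum_slice g xi (fun=> 1)).
by apply: eq_bigr => x _; rewrite mulr1.
Qed.

Lemma sliceE g xi t : slice g xi t = \sum_x g x * (dot xi x == t)%:R.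
Proof. by rewrite /slice big_mkcond; apply: eq_bigr => x _; case: eqP; rewrite ?mulr1 ?mulr0. Qed.

(** The weight from [sum_forms] acts as a point mass at [y], because its constant part is killed by
    the zero mean of [g]. *)
Lemma sum_pick g y : \sum_x g x = 0 ->
  \sum_x g x * (M * (1 + (q - 1) * (x - y == 0)%:R)) = M * (q - 1) * g y.
Proof.
move=> g0.
rewrite (eq_bigr (fun x => M * g x + g x * M * (q - 1) * (x == y)%:R)) => [|x _].
  rewrite big_split /= -mulr_sumr g0 mulr0 add0r (bigD1 y) //= eqxx big1 => [|x /negPf->].
    by rewrite mulr1 addr0; ring.
  by rewrite mulr0.
by rewrite subr_eq0; ring.
Qed.

(** The squares expand over pairs with [dot xi (y - x) = 0]; summing over [xi] first leaves only the
    diagonal. *)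
Lemma plancherel g : \sum_x g x = 0 ->
  q * \sum_xi \sum_t slice g xi t ^+ 2 = (q - 1) * M * \sum_x g x ^+ 2.
Proof.
move=> g0.
transitivity (\sum_x \sum_y g x * g y * (M * (1 + (q - 1) * (y - x == 0)%:R))).
  rewrite mulr_sumr.
  under [LHS]eq_bigr => xi _.
    under eq_bigr => t _ do rewrite expr2.
    rewrite (sum_slice g xi (slice g xi)) mulr_sumr.
    under eq_bigr => x _ do rewrite sliceE mulr_sumr mulr_sumr.
    over.
  rewrite exchange_big /=; apply: eq_bigr => x _.
  rewrite exchange_big /=; apply: eq_bigr => y _.
  rewrite -sum_forms !mulr_sumr; apply: eq_bigr => xi _.
  rewrite dotD dotN subr_eq0; ring.
under eq_bigr => x _.
  under eq_bigr => y _ do rewrite -mulrA.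
  rewrite -mulr_sumr (sum_pick _ g0); over.
rewrite mulr_sumr; apply: eq_bigr => x _; ring.
Qed.

(** A free third point [z] is introduced, and the sum over forms vanishing at [z - (y *+ 2 - x)]
    enforces the progression. *)
Lemma ap3_forms g : \sum_x g x = 0 ->
  (q - 1) * M * ap3 g g g =
  q * \sum_xi \sum_s \sum_t slice g xi s * slice g xi t * slice g xi (t *+ 2 - s).
Proof.
move=> g0.
transitivity (\sum_x \sum_y \sum_z g x * g y * g z *
   (M * (1 + (q - 1) * (z - (y *+ 2 - x) == 0)%:R))).
  rewrite /ap3 mulr_sumr; apply: eq_bigr => x _; rewrite mulr_sumr; apply: eq_bigr => y _.
  under [RHS]eq_bigr => z _ do rewrite -mulrA.
  by rewrite -mulr_sumr (sum_pick _ g0); ring.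
rewrite mulr_sumr.
under [RHS]eq_bigr => xi _.
  under eq_bigr => s _.
    under eq_bigr => t _ do rewrite -mulrA.
    rewrite -mulr_sumr (sum_slice g xi (fun t => slice g xi (t *+ 2 - s))).
    over.
  rewrite (sum_slice g xi (fun s => \sum_x g x * slice g xi (dot xi x *+ 2 - s))) mulr_sumr.
  under eq_bigr => x _.
    rewrite mulr_sumr mulr_sumr.
    under eq_bigr => y _ do rewrite sliceE !mulr_sumr.
    over.
  over.
rewrite [RHS]exchange_big /=; apply: eq_bigr => x _.
rewrite [RHS]exchange_big /=; apply: eq_bigr => y _.
rewrite [RHS]exchange_big /=; apply: eq_bigr => z _.
rewrite -sum_forms !mulr_sumr; apply: eq_bigr => xi _.
rewrite dotD dotN dotD dotN dotMn subr_eq0; ring.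
Qed.

(** In [ap3_forms], one factor is bounded by [B], the product of the other two by half the sum of
    their squares, and [plancherel] evaluates the result. *)
Lemma ap3_le g (B : R) : \sum_x g x = 0 ->
  (forall xi t, `|slice g xi t| <= B) ->
  `|ap3 g g g| <= q * B * \sum_x g x ^+ 2.
Proof.
move=> g0 gB; have q1 := card_gt1; have q0 := card_gt0.
have M0 : 0 < M by rewrite ltr0n; apply/card_gt0P; exists 0.
have B0 : 0 <= B := le_trans (normr_ge0 _) (gB 0 0).
have c0 : 0 < (q - 1) * M by rewrite mulr_gt0 // subr_gt0.
rewrite -(ler_pM2l c0) -{1}(ger0_norm (ltW c0)) -normrM ap3_forms // normrM.
rewrite (ger0_norm (ltW q0)).
have -> : (q - 1) * M * (q * B * \sum_x g x ^+ 2) =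
    q * (B * (q * \sum_xi \sum_t slice g xi t ^+ 2)) by rewrite plancherel //; ring.
rewrite ler_pM2l // !mulr_sumr; apply: le_trans (ler_norm_sum _ _ _) _.
apply: ler_sum => xi _; set G := slice g xi.
have -> : B * (q * \sum_t G t ^+ 2) =
    \sum_s \sum_t (B * G s ^+ 2 / 2 + B * G t ^+ 2 / 2).
  under [RHS]eq_bigr => s _ do rewrite big_split /= sumr_const -[X in X + _]mulr_natl.
  rewrite big_split /= sumr_const -[X in _ + X]mulr_natl -!mulr_sumr -!mulr_suml.
  by rewrite -!mulr_sumr; field.
apply: le_trans (ler_norm_sum _ _ _) _; apply: ler_sum => s _.
apply: le_trans (ler_norm_sum _ _ _) _; apply: ler_sum => t _.
rewrite normrM; apply: le_trans (ler_wpM2l (normr_ge0 _) (gB _ _)) _.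
have: 0 <= B * (`|G s| - `|G t|) ^+ 2 by rewrite mulr_ge0 // sqr_ge0.
rewrite normrM -[in X in _ -> X](real_normK (num_real (G s))).
rewrite -[in X in _ -> X](real_normK (num_real (G t))); lra.
Qed.
End Counting.

(** * Averaging over cosets *)

Section Cosets.
Context {R : realFieldType} {F : finFieldType} {n : nat}.
Implicit Types (a b c f g u : 'rV[F]_n -> R) (x y v w : 'rV[F]_n).
Implicit Types (xi : 'cV[F]_n) (W : {vspace 'rV[F]_n}).

Definition coset_invariant W f := forall x w, w \in W -> f (x + w) = f x.
Definition mean_zero W f := forall x, \sum_(w in W) f (x + w) = 0.
Definition coset_avg W f x : R := #|W|%:R^-1 * \sum_(w in W) f (x + w).

Lemma card_vs_gt0 W : 0 < #|W|%:R :> R.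
Proof. by rewrite ltr0n; apply/card_gt0P; exists 0; apply: mem0v. Qed.

Lemma sum_coset W w0 (k : 'rV[F]_n -> R) : w0 \in W ->
  \sum_(w in W) k (w0 + w) = \sum_(w in W) k w.
Proof.
move=> Ww0; rewrite [RHS](reindex_inj (addrI w0)) /=.
by apply: eq_bigl => w; rewrite rpredDl.
Qed.

Lemma avg_inv W f : coset_invariant W (coset_avg W f).
Proof.
move=> x w Ww; rewrite /coset_avg; congr (_ * _).
rewrite -(sum_coset (fun w => f (x + w)) Ww).
by apply: eq_bigr => w' _; rewrite addrA.
Qed.

Lemma mean_zero_sub_avg W f : mean_zero W (fun x => f x - coset_avg W f x).
Proof.
move=> x; rewrite sumrB [X in _ - X](eq_bigr (fun=> coset_avg W f x)) => [|w Ww]; last first.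
  by rewrite avg_inv.
rewrite sumr_const -mulr_natl /coset_avg mulrA divff ?mul1r ?subrr //.
by rewrite gt_eqF ?card_vs_gt0.
Qed.

Lemma sum_coset_all W (K : 'rV[F]_n -> R) :
  #|W|%:R * \sum_x K x = \sum_x \sum_(w in W) K (x + w).
Proof.
rewrite exchange_big /= [RHS](eq_bigr (fun _ => \sum_x K x)) => [|w _].
  by rewrite sumr_const -[RHS]mulr_natl.
by rewrite [RHS](reindex_inj (addIr w)).
Qed.

(** On each coset of [W] the factor [k] is constant and [g] sums to zero; thus [coset_avg] is an
    orthogonal projection. *)
Lemma sum_mean_zero W g k : mean_zero W g -> coset_invariant W k ->
  \sum_x g x * k x = 0.
Proof.
move=> g0 ki; apply: (mulfI (lt0r_neq0 (card_vs_gt0 W))).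
rewrite sum_coset_all mulr0 big1 // => x _.
rewrite (eq_bigr (fun w => g (x + w) * k x)) => [|w Ww]; last by rewrite ki.
by rewrite -mulr_suml g0 mul0r.
Qed.

Lemma sum_mean_zero1 W g : mean_zero W g -> \sum_x g x = 0.
Proof.
move=> g0; rewrite -[RHS](sum_mean_zero (k := fun=> 1) g0) //.
by apply: eq_bigr => x _; rewrite mulr1.
Qed.

Lemma sum_avgM W f k : coset_invariant W k ->
  \sum_x coset_avg W f x * k x = \sum_x f x * k x.
Proof.
move=> ki; apply/esym/eqP; rewrite -subr_eq0 -sumrB; apply/eqP.
rewrite -[RHS](sum_mean_zero (mean_zero_sub_avg W f) ki).
by apply: eq_bigr => x _; rewrite mulrBl.
Qed.

Lemma sum_avg1 W f : \sum_x coset_avg W f x = \sum_x f x.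
Proof.
apply/esym/eqP; rewrite -subr_eq0 -sumrB; apply/eqP.
exact: sum_mean_zero1 (mean_zero_sub_avg W f).
Qed.

Lemma avg_itv W f : (forall x, 0 <= f x <= 1) -> forall x, 0 <= coset_avg W f x <= 1.
Proof.
move=> f01 x; have c0 := card_vs_gt0 W.
have le (r : R) : \sum_(w in W) r = #|W|%:R * r by rewrite sumr_const mulr_natl.
rewrite /coset_avg mulrC ler_pdivlMr // mul0r ler_pdivrMr // mul1r.
rewrite -[#|W|%:R]mulr1 -le sumr_ge0 => [|w _]; last by case/andP: (f01 (x + w)).
by apply: ler_sum => w _; case/andP: (f01 (x + w)).
Qed.

(** Reflection [x -> y *+ 2 - x] about the middle term exchanges the end terms. *)
Lemma ap3_sym a b c : ap3 a b c = ap3 c b a.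
Proof.
rewrite /ap3 exchange_big [RHS]exchange_big; apply: eq_bigr => y _ /=.
rewrite (reindex_inj (inj_comp (addrI (y *+ 2)) oppr_inj)) /=.
by apply: eq_bigr => x _; rewrite opprB [_ + (x - _)]addrC subrK; ring.
Qed.

Lemma ap3Dl a a' b c : ap3 (fun x => a x + a' x) b c = ap3 a b c + ap3 a' b c.
Proof.
rewrite /ap3 -big_split; apply: eq_bigr => x _; rewrite -big_split.
by apply: eq_bigr => y _; rewrite !mulrDl.
Qed.

Lemma ap3Dm a b b' c : ap3 a (fun x => b x + b' x) c = ap3 a b c + ap3 a b' c.
Proof.
rewrite /ap3 -big_split; apply: eq_bigr => x _; rewrite -big_split.
by apply: eq_bigr => y _; rewrite mulrDr mulrDl.
Qed.

Lemma ap3Dr a b c c' : ap3 a b (fun x => c x + c' x) = ap3 a b c + ap3 a b c'.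
Proof. by rewrite ap3_sym ap3Dl !(ap3_sym _ _ a). Qed.

(** Translating [x] by [w] and [y] by [w/2] fixes the third term and does not affect [b], so
    averaging over [w] in [W] acts on [a] alone. Halving [w] requires odd characteristic. *)
Lemma ap3_mzl W a b c : 2%:R != 0 :> F -> mean_zero W a -> coset_invariant W b ->
  ap3 a b c = 0.
Proof.
move=> F2 a0 bi; apply: (mulfI (lt0r_neq0 (card_vs_gt0 W))); rewrite mulr0.
transitivity (\sum_(w in W) \sum_x \sum_y a (x + w) * b y * c (y *+ 2 - x)).
  rewrite mulr_natl -sumr_const; apply: eq_bigr => w Ww.
  rewrite /ap3 (reindex_inj (addIr w)); apply: eq_bigr => x _ /=.
  rewrite (reindex_inj (addIr (2%:R^-1 *: w))); apply: eq_bigr => y _ /=.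
  rewrite bi ?rpredZ //; congr (_ * c _).
  rewrite mulrnDl -(scaler_nat 2 (_ *: w)) scalerA divff // scale1r.
  by rewrite opprD addrACA subrr addr0.
rewrite exchange_big big1 //= => x _; rewrite exchange_big big1 //= => y _.
under eq_bigr => w _ do rewrite -mulrA.
by rewrite -mulr_suml a0 mul0r.
Qed.

(** Here [y] moves by [w] and [x] by [w *+ 2]: the third term is again fixed, and only [b] feels the
    averaging. *)
Lemma ap3_mzm W a b c : coset_invariant W a -> mean_zero W b -> ap3 a b c = 0.
Proof.
move=> ai b0; apply: (mulfI (lt0r_neq0 (card_vs_gt0 W))); rewrite mulr0.
transitivity (\sum_(w in W) \sum_x \sum_y a x * b (y + w) * c (y *+ 2 - x)).
  rewrite mulr_natl -sumr_const; apply: eq_bigr => w Ww.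
  rewrite /ap3 (reindex_inj (addIr (w *+ 2))); apply: eq_bigr => x _ /=.
  rewrite (reindex_inj (addIr w)); apply: eq_bigr => y _ /=.
  rewrite ai ?rpredMn //; congr (_ * c _).
  by rewrite mulrnDl opprD addrACA subrr addr0.
rewrite exchange_big big1 //= => x _; rewrite exchange_big big1 //= => y _.
under eq_bigr => w _ do rewrite mulrAC.
by rewrite -mulr_sumr b0 mulr0.
Qed.

(** Each of the six mixed terms vanishes by [ap3_mzl] or [ap3_mzm], if necessary after a
    reflection. *)
Lemma ap3_orthoD W f g : 2%:R != 0 :> F -> coset_invariant W f -> mean_zero W g ->
  ap3 (fun x => f x + g x) (fun x => f x + g x) (fun x => f x + g x) =
  ap3 f f f + ap3 g g g.
Proof.
move=> F2 fi g0; rewrite ap3Dl !ap3Dm !ap3Dr.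
rewrite [ap3 f f g]ap3_sym ![ap3 g f _](ap3_mzl _ F2 g0 fi).
by rewrite ![ap3 f g _](ap3_mzm _ fi g0) [ap3 g g f]ap3_sym (ap3_mzm _ fi g0) !(addr0, add0r).
Qed.

End Cosets.

(** * Roth's theorem *)

Section Roth.
Context {R : realType} {F : finFieldType} {n : nat}.
Implicit Types (a b c f g u : 'rV[F]_n -> R) (x y v w : 'rV[F]_n).
Implicit Types (xi : 'cV[F]_n) (W : {vspace 'rV[F]_n}).

Let q : R := #|F|%:R.
Let M : R := #|{: 'rV[F]_n}|%:R.

Lemma space_gt0 : 0 < M.
Proof. by rewrite ltr0n; apply/card_gt0P; exists 0. Qed.

Lemma mean_zero_fullv g : \sum_x g x = 0 -> mean_zero fullv g.
Proof.
move=> g0 x; rewrite -[RHS]g0 [RHS](reindex_inj (addrI x)).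
by apply: eq_bigl => w; rewrite memvf.
Qed.

Lemma sum_dot xi (k : F -> R) : xi != 0 ->
  q * \sum_x k (dot xi x) = M * \sum_s k s.
Proof.
move=> /exists_dot1[v xiv]; rewrite (sum_avg (fun s => s *: v)).
rewrite [LHS](eq_bigr (fun=> \sum_s k s)) => [|x _].
  by rewrite sumr_const -[LHS]mulr_natl.
rewrite [RHS](reindex_inj (addrI (dot xi x))).
by apply: eq_bigr => s _; rewrite dotD dotZ xiv mulr1.
Qed.

Lemma slice0 g t : \sum_x g x = 0 -> slice g 0 t = 0.
Proof.
move=> g0; have [->|t0] := eqVneq t 0.
  by rewrite -[RHS]g0; apply: eq_bigl => x; rewrite /dot mulmx0 mxE eqxx.
by apply: big1 => x; rewrite /dot mulmx0 mxE eq_sym (negPf t0).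
Qed.

Lemma slice_subr g (r : R) xi t : xi != 0 ->
  slice (fun x => g x - r) xi t = slice g xi t - r * M / q.
Proof.
move=> xi0; rewrite [LHS]sumrB -/(slice g xi t); congr (_ - _).
have q0 := card_gt0 (R := R) (F := F); apply: (mulfI (lt0r_neq0 q0)).
rewrite big_mkcond (sum_dot (fun s => if s == t then r else 0)) // -big_mkcond.
by rewrite big_pred1_eq; field; rewrite lt0r_neq0.
Qed.

(** Split [u] as its mean plus [g]. The constant contributes [M^2 * beta^3], and [ap3_le] bounds the
    rest, with the sum of [g^2] at most [beta * M] because [u^2 <= u]. *)
Lemma ap3_ge_uniform u (eta : R) (beta := (\sum_x u x) / M) :
  2%:R != 0 :> F -> (forall x, 0 <= u x <= 1) ->
  (forall xi t, `|slice (fun x => u x - beta) xi t| <= eta * M / q) ->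
  M ^+ 2 * (beta ^+ 3 - eta * beta) <= ap3 u u u.
Proof.
move=> F2 u01 Hs; have M0 := space_gt0; have q0 := card_gt0 (R := R) (F := F).
have uE : \sum_x u x = beta * M by rewrite /beta divfK // lt0r_neq0.
have sc (r : R) : \sum_(x : 'rV[F]_n) r = M * r by rewrite sumr_const -[LHS]mulr_natl.
set g := fun x => u x - beta.
have g0 : \sum_x g x = 0 by rewrite sumrB uE sc mulrC subrr.
pose cb (x : 'rV[F]_n) := beta.
have -> : ap3 u u u = ap3 cb cb cb + ap3 g g g.
  rewrite -(ap3_orthoD (W := fullv) F2) //; last exact: mean_zero_fullv.
  by apply: eq_bigr => x _; apply: eq_bigr => y _; rewrite /g /cb !(addrC beta) !subrK.
have -> : ap3 cb cb cb = M ^+ 2 * beta ^+ 3 by rewrite /ap3 /cb !sc; ring.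
have Tg := ap3_le g0 Hs.
have eta0 : 0 <= eta.
  have := le_trans (normr_ge0 _) (Hs 0 0).
  by rewrite pmulr_lge0 ?invr_gt0 // pmulr_lge0.
have g2 : \sum_x g x ^+ 2 <= beta * M.
  rewrite -uE -subr_ge0 -sumrB.
  have -> : \sum_x (u x - g x ^+ 2) =
      \sum_x (u x - u x ^+ 2 + beta ^+ 2) + 2 * beta * \sum_x g x.
    by rewrite mulr_sumr -big_split; apply: eq_bigr => x _; rewrite /= /g; ring.
  rewrite g0 mulr0 addr0; apply: sumr_ge0 => x _.
  by rewrite addr_ge0 ?sqr_ge0 // subr_ge0 expr2 ler_piMl //; case/andP: (u01 x).
have : - ap3 g g g <= q * (eta * M / q) * (beta * M).
  apply: le_trans (ler_norm _) _; rewrite normrN; apply: le_trans Tg _.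
  by rewrite ler_wpM2l // !mulr_ge0 ?invr_ge0 // ltW.
by rewrite [q * _]mulrC divfK ?lt0r_neq0 //; nra.
Qed.

(* Pulling u back along an affine map onto the hyperplane dot xi = t keeps
   the ambient dimension fixed during the density increment. *)
Lemma density_increment u (e : R) (beta := (\sum_x u x) / M) xi t :
  (forall x, 0 <= u x <= 1) -> e * M / q < slice (fun x => u x - beta) xi t ->
  xi != 0 ->
  exists u' : 'rV[F]_n -> R, [/\ forall x, 0 <= u' x <= 1,
    (beta + e) * M < \sum_x u' x & ap3 u' u' u' <= q ^+ 2 * ap3 u u u].
Proof.
move=> u01 Hst xi0; have M0 := space_gt0; have q0 := card_gt0 (R := R) (F := F).
have [v xiv] := exists_dot1 xi0.
exists (fun x => u (x + (t - dot xi x) *: v)); split => [x||] /=; first exact: u01.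
(* The map is the projection along [v] onto the hyperplane [dot xi = t]; each point there has [q]
   preimages. *)
- have -> : \sum_x u (x + (t - dot xi x) *: v) = q * slice u xi t.
    rewrite sliceE (sum_avg (fun s => s *: v)); apply: eq_bigr => x _.
    rewrite (bigD1 (t - dot xi x)) //= big1 => [|s st].
      by rewrite dotD dotZ xiv mulr1 [_ + (t - _)]addrC subrK eqxx mulr1 addr0.
    rewrite dotD dotZ xiv mulr1 (_ : (_ == t) = false) ?mulr0 //.
    by apply: contraNF st => /eqP <-; rewrite addrAC subrr add0r.
  move: Hst; rewrite slice_subr // ltrBrDr -mulrDl -mulrDl [e + _]addrC.
  by rewrite ltr_pdivrMr // [X in _ < X]mulrC.
(* Among the [q^2] shifts of [(x, y)] along [v], exactly one lies in the hyperplane; the others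
   contribute nonnegative terms and are dropped. *)
- rewrite /ap3 (sum_avg2 v); apply: ler_sum => x _; apply: ler_sum => y _.
  have u0 z : 0 <= u z by case/andP: (u01 z).
  rewrite (bigD1 (t - dot xi x)) //= (bigD1 (t - dot xi y)) //=.
  set z := (_ + _) *+ 2 - (x + _).
  have -> : z = y *+ 2 - x + (t - dot xi (y *+ 2 - x)) *: v.
    rewrite /z dotD dotN dotMn mulrnDl opprD addrACA; congr (_ + _).
    rewrite scalerMnl -scalerBl; congr (_ *: _); ring.
  apply: ler_wpDr; last apply: ler_wpDr; last exact: lexx.
    by apply: sumr_ge0 => s _; apply: sumr_ge0 => r _; rewrite !mulr_ge0.
  by apply: sumr_ge0 => r _; rewrite !mulr_ge0.
Qed.

(** The slices sum to zero, so if all are at most [e], none is below [-(q - 1) * e]. Passing from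
    absolute values to a positive excess thus costs a factor [q]. *)
Lemma slice_pos_increment g xi t (e : R) : \sum_x g x = 0 ->
  q * e < `|slice g xi t| -> exists s, e < slice g xi s.
Proof.
move=> g0 Ht; apply/existsP; apply: contraLR Ht => /existsPn Hle.
have {}Hle s : slice g xi s <= e by rewrite leNgt Hle.
have S0 : \sum_s slice g xi s = 0 by rewrite sum_slice1.
have e0 : 0 <= e.
  have q0 := card_gt0 (R := R) (F := F).
  rewrite -(pmulr_rge0 _ q0) -S0 mulr_natl -sumr_const.
  exact: ler_sum.
have q1 : 1 <= q by apply: ltW; apply: card_gt1.
rewrite -leNgt ler_norml; apply/andP; split; last first.
  by apply: le_trans (Hle t) _; rewrite ler_peMl.
move: S0; rewrite (bigD1 t) //= => /eqP; rewrite addr_eq0 => /eqP ->.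
rewrite lerN2; apply: (@le_trans _ _ (\sum_(s | s != t) e)); first exact: ler_sum.
rewrite [leRHS]mulr_natl -sumr_const [leRHS](bigD1 t) //=.
by rewrite lerDr.
Qed.

End Roth.

(** Here [k] counts the density increments still possible. Each one gains [b^2/(2q)] in density and
    costs a factor [q^2] in the progression count; at [k = 0] the density would exceed 1. *)
Lemma roth_iteration {R : realType} {F : finFieldType} {n : nat} (b : R) (k : nat)
    (u : 'rV[F]_n -> R) (q : R := #|F|%:R) (M : R := #|{: 'rV[F]_n}|%:R) :
  2%:R != 0 :> F -> 0 < b -> (forall x, 0 <= u x <= 1) ->
  b * M <= \sum_x u x -> (1 - k%:R * (b ^+ 2 / 2 / q)) * M < \sum_x u x ->
  q ^- (2 * k) * (b ^+ 3 / 2) * M ^+ 2 <= ap3 u u u.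
Proof.
move=> F2 b0; have M0 : 0 < M := space_gt0.
have q1 : 1 < q := card_gt1; have q0 : 0 < q := card_gt0.
elim: k u => [|k IH] u u01 bu.
  rewrite mul0r subr0 mul1r ltNge => /negP[].
  rewrite /M -sumr_const; apply: ler_sum => x _; by case/andP: (u01 x).
set beta := (\sum_x u x) / M; set eta := b ^+ 2 / 2 => Hk.
have uE : \sum_x u x = beta * M by rewrite /beta divfK // lt0r_neq0.
have bbeta : b <= beta by move: bu; rewrite uE ler_pM2r.
set g := fun x => u x - beta.
have [/forallP small|] := boolP [forall xi : 'cV[F]_n, forall t, `|slice g xi t| <= eta * M / q].
  have := ap3_ge_uniform F2 u01 (fun xi t => forallP (small xi) t).
  apply: le_trans; rewrite -/M -/beta [leLHS]mulrC ler_pM2l ?exprn_gt0 //.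
  apply: (@le_trans _ _ (b ^+ 3 / 2)).
    rewrite ger_pMl ?divr_gt0 ?exprn_gt0 //.
    by rewrite invf_le1 ?exprn_gt0 // exprn_ege1 // ltW.
  (* As [beta >= b], the bracket is at least [b^2/2], which makes the uniform count at least
     [b^3/2]. *)
  have -> : beta ^+ 3 - eta * beta = beta * (beta ^+ 2 - b ^+ 2 / 2) by rewrite /eta; ring.
  have -> : b ^+ 3 / 2 = b * (b ^+ 2 / 2) by ring.
  have bb : b ^+ 2 <= beta ^+ 2 by rewrite ler_sqr ?nnegrE ?(le_trans _ bbeta) // ltW.
  have b2 : 0 < b ^+ 2 by rewrite exprn_gt0.
  by apply: ler_pM; lra.
rewrite negb_forall => /existsP[xi]; rewrite negb_forall => /existsP[t].
rewrite -ltNge => Ht.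
have g0 : \sum_x g x = 0.
  by rewrite sumrB uE sumr_const -[X in _ - X]mulr_natl mulrC subrr.
have xi0 : xi != 0.
  apply: contraTneq Ht => ->; rewrite slice0 // normr0 -leNgt.
  by rewrite !mulr_ge0 ?invr_ge0 ?ltW // exprn_gt0.
have [|s Hs] := @slice_pos_increment R F n g xi t (eta / q * M / q) g0.
  by apply: le_lt_trans Ht; rewrite le_eqVlt; apply/orP; left; apply/eqP; field; rewrite lt0r_neq0.
have [u' [u'01 Su' Tu']] := density_increment u01 Hs xi0.
rewrite -/M -/beta in Su'.
have eta0 : 0 <= eta / q * M by rewrite !mulr_ge0 ?invr_ge0 ?ltW // exprn_gt0.
have bu' : b * M <= \sum_x u' x.
  by apply: le_trans (ltW Su'); rewrite mulrDl -uE -[leLHS]addr0 lerD.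
have Hk' : (1 - k%:R * (eta / q)) * M < \sum_x u' x.
  apply: lt_trans Su'; rewrite [X in _ < X]mulrDl -uE; move: Hk.
  by rewrite -[k.+1]addn1 natrD -/eta; lra.
have q20 : 0 < q ^+ 2 by rewrite exprn_gt0.
rewrite -(ler_pM2l q20); apply: le_trans Tu'; apply: le_trans (IH u' u'01 bu' Hk').
by rewrite mulnS exprD invfM !mulrA divff ?mul1r // lt0r_neq0.
Qed.

Lemma roth {R : realType} (F : finFieldType) (b : R) :
  2%:R != 0 :> F -> 0 < b -> exists2 d : R, 0 < d &
  forall n (u : 'rV[F]_n -> R), (forall x, 0 <= u x <= 1) ->
    b * #|{: 'rV[F]_n}|%:R <= \sum_x u x ->
    d * #|{: 'rV[F]_n}|%:R ^+ 2 <= ap3 u u u.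
Proof.
move=> F2 b0; set q : R := #|F|%:R; have q0 : 0 < q := card_gt0.
set e := b ^+ 2 / 2 / q; have e0 : 0 < e by rewrite !divr_gt0 ?exprn_gt0.
(* Since [k * e >= 1], the density threshold of [roth_iteration] is nonpositive at the start.
   Neither [k] nor the resulting constant depends on [n]. *)
set k := Num.bound e^-1.
exists (q ^- (2 * k) * (b ^+ 3 / 2)); first by rewrite mulr_gt0 ?invr_gt0 ?divr_gt0 ?exprn_gt0.
move=> n u u01 bu; apply: roth_iteration => //; apply: lt_le_trans bu.
have M0 : 0 < #|{: 'rV[F]_n}|%:R :> R := space_gt0.
apply: (@le_lt_trans _ _ 0); last by rewrite mulr_gt0.
rewrite pmulr_lle0 // subr_le0 -/q -/e -ler_pdivrMr // mul1r ltW //.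
by apply: archi_boundP; rewrite invr_ge0 ltW.
Qed.

(** * Regularity and perturbation *)

Section Structure.
Context {R : realType} {F : finFieldType} {n : nat}.
Implicit Types (a b c f g u : 'rV[F]_n -> R) (x y v w : 'rV[F]_n).
Implicit Types (xi : 'cV[F]_n) (W : {vspace 'rV[F]_n}).

Let q : R := #|F|%:R.
Let M : R := #|{: 'rV[F]_n}|%:R.

(** [W] is the kernel of the map to [F^|S|] whose coordinates are the forms in [S]; rank-nullity
    bounds its codimension. *)
Lemma annihilator (S : {set 'cV[F]_n}) : exists W,
  (forall xi w, xi \in S -> w \in W -> dot xi w = 0) /\ (n <= \dim W + #|S|)%N.
Proof.
pose A : 'M[F]_(n, #|S|) := \matrix_(i, j) (enum_val j : 'cV[F]_n) i 0.
exists (lker (linfun (mulmxr A))); split => [xi w Sxi|].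
  rewrite memv_ker lfunE /= => /eqP/rowP/(_ (enum_rank_in Sxi xi)).
  rewrite !mxE /dot mxE => wA; rewrite -[RHS]wA; apply: eq_bigr => i _.
  by rewrite mxE enum_rankK_in.
set phi : 'Hom('rV_n, 'rV_#|S|) := linfun _.
have := limg_ker_dim phi fullv; rewrite (capv_idPr (subvf _)) dimvf /dim /= mul1n => {1}<-.
by rewrite leq_add2l; apply: leq_trans (dimvS (subvf _)) _; rewrite dimvf /dim /= mul1n.
Qed.

Lemma slice_mean_zero W g xi t : mean_zero W g ->
  (forall w, w \in W -> dot xi w = 0) -> slice g xi t = 0.
Proof.
move=> g0 xiW; rewrite sliceE.
apply: (sum_mean_zero (k := fun x => (dot xi x == t)%:R) g0) => x w Ww.
by rewrite dotD (xiW w) ?addr0.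
Qed.

(** Translation by multiples of [w] permutes the slices transitively, so they are all equal, and
    their total is zero. *)
Lemma slice_invariant W g xi t w : coset_invariant W g -> w \in W -> dot xi w = 1 ->
  \sum_x g x = 0 -> slice g xi t = 0.
Proof.
move=> gi Ww xiw g0; have q0 : 0 < q := card_gt0.
apply: (mulfI (lt0r_neq0 q0)); rewrite mulr0 -[RHS]g0 -(sum_slice1 g xi).
rewrite mulr_natl -sumr_const [RHS](reindex_inj (addrI t)); apply: eq_bigr => s _.
rewrite /slice [RHS](reindex_inj (addIr (s *: w))); apply: eq_big => x.
  by rewrite dotD dotZ xiw mulr1 (inj_eq (addIr s)).
by rewrite gi // rpredZ.
Qed.

Lemma regularity f (eta : R) : 0 < eta -> (forall x, 0 <= f x <= 1) ->
  exists W (K : nat), [/\ (n <= \dim W + K)%N, K%:R <= (q / eta) ^+ 2 &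
   forall xi t, `|slice (fun x => f x - coset_avg W f x) xi t| <= eta * M / q].
Proof.
move=> eta0 f01; have q0 : 0 < q := card_gt0; have M0 : 0 < M := space_gt0.
set r := (\sum_x f x) / M; pose g x := f x - r.
have g0 : \sum_x g x = 0.
  by rewrite sumrB sumr_const -[X in _ - X]mulr_natl mulrC divfK ?subrr // lt0r_neq0.
pose S := [set xi | [exists t, eta * M / q < `|slice g xi t|]].
have [W [WS dimW]] := annihilator S; exists W, #|S|; split => // [|xi t].
- have r01 : 0 <= r <= 1.
    rewrite /r ler_pdivlMr // mul0r ler_pdivrMr // mul1r sumr_ge0 => [|x _].
      by rewrite /M -sumr_const; apply: ler_sum => x _; case/andP: (f01 x).
    by case/andP: (f01 x).
  have g2 : \sum_x g x ^+ 2 <= M.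
    rewrite /M -sumr_const; apply: ler_sum => x _; rewrite /g.
    by case/andP: (f01 x); case/andP: r01; nra.
  have := plancherel g0; rewrite -/q -/M => gE.
  (* Every form in [S] has a slice exceeding [eta * M / q], so it contributes at least the square of
     this to the sum in [plancherel]. *)
  have : #|S|%:R * (eta * M / q) ^+ 2 <= M * M.
    apply: (@le_trans _ _ (\sum_xi \sum_t slice g xi t ^+ 2)).
      rewrite mulr_natl -sumr_const [leRHS](bigID (mem S)) /= ler_wpDr //.
        by apply: sumr_ge0 => xi _; apply: sumr_ge0 => t _; apply: sqr_ge0.
      apply: ler_sum => xi; rewrite inE => /existsP[t /ltW Ht].
      rewrite (bigD1 t) //= ler_wpDr //; first by apply: sumr_ge0 => s _; apply: sqr_ge0.
      rewrite -[leRHS]real_normK ?num_real // ler_sqr ?nnegrE //.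
      by rewrite !mulr_ge0 ?invr_ge0 // ltW.
    rewrite -(ler_pM2l q0) gE; have q1 : 1 < q := card_gt1.
    have s0 : 0 <= \sum_x g x ^+ 2 by apply: sumr_ge0 => x _; apply: sqr_ge0.
    rewrite -mulrA; apply: ler_pM; rewrite ?ler_wpM2l // ?(mulr_ge0 (ltW M0)) //; lra.
  have -> : (eta * M / q) ^+ 2 = (M * M) / (q / eta) ^+ 2.
    by field; rewrite !lt0r_neq0.
  rewrite mulrCA -[leRHS]mulr1 ler_pM2l ?mulr_gt0 //.
  by rewrite ler_pdivrMr ?mul1r // exprn_gt0 // divr_gt0.
have B0 : 0 <= eta * M / q by rewrite !mulr_ge0 ?invr_ge0 // ltW.
have k0 := mean_zero_sub_avg W f.
(* A form vanishing on [W] has zero slices against [f - coset_avg W f]. Any other form lies outside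
   [S] and does not see [coset_avg W f - r], so its slices are those of [g], which are small. *)
have [/forallP xiW|] := boolP [forall w in W, dot xi w == 0].
  rewrite (slice_mean_zero t k0) ?normr0 // => w Ww.
  by apply/eqP; have := xiW w; rewrite Ww.
rewrite negb_forall => /existsP[w]; rewrite negb_imply => /andP[Ww xiw].
have SNxi : xi \notin S by apply: contra xiw => Sxi; apply/eqP; apply: WS.
have -> : slice (fun x => f x - coset_avg W f x) xi t = slice g xi t; last first.
  by move: SNxi; rewrite inE negb_exists => /forallP/(_ t); rewrite -leNgt.
apply/eqP; rewrite -subr_eq0 -oppr_eq0 opprB -sumrB; apply/eqP.
rewrite -[RHS](@slice_invariant W (fun x => coset_avg W f x - r) xi t ((dot xi w)^-1 *: w)).
- by apply: eq_bigr => x _; rewrite /g; ring.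
- by move=> x w' Ww'; rewrite avg_inv.
- by rewrite rpredZ.
- by rewrite dotZ mulVf.
- by rewrite sumrB sum_avg1 -sumrB.
Qed.

(* Any mean-zero weight on F with negative progression sum would do. *)
Definition wave (s : F) : R := q^-1 - (s == 0)%:R.

Lemma sum_wave : \sum_s wave s = 0.
Proof.
have q0 : 0 < q := card_gt0.
rewrite sumrB sumr_const -[X in X - _]mulr_natl divff ?lt0r_neq0 //.
by rewrite (bigD1 0) //= eqxx big1 ?addr0 ?subrr // => s /negPf->.
Qed.

Lemma wave_le1 s : `|wave s| <= 1.
Proof.
have q1 : 1 < q := card_gt1; have q0 : 0 < q := card_gt0.
have i0 : 0 < q^-1 by rewrite invr_gt0.
have i1 : q^-1 < 1 by rewrite invf_lt1.
by rewrite /wave ler_norml; case: eqP => _; apply/andP; split; rewrite /=; lra.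
Qed.

(** By [pick], summing against [wave (s *+ 2 - r)] evaluates a mean-zero function at [r/2], up to
    sign. Two applications leave [wave 0], which is negative. *)
Lemma wave_progressions : 2%:R != 0 :> F ->
  \sum_s \sum_t wave s * wave t * wave (t *+ 2 - s) = q^-1 - 1.
Proof.
move=> F2.
have dbl (s : F) : s *+ 2 = 2%:R * s by rewrite mulr_natl.
have pick (k : F -> R) r : \sum_s k s * wave (s *+ 2 - r) = q^-1 * \sum_s k s - k (r / 2%:R).
  rewrite mulr_sumr (eq_bigr (fun s => q^-1 * k s - k s * (s == r / 2%:R)%:R)) => [|s _].
    rewrite sumrB; congr (_ - _); rewrite (bigD1 (r / 2%:R)) //= eqxx mulr1 big1 ?addr0 //.
    by move=> s /negPf->; rewrite mulr0.
  rewrite /wave subr_eq0 dbl mulrC mulrBl -(inj_eq (mulfI F2) s) mulrCA divff // mulr1.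
  by congr (_ - _); rewrite mulrC.
transitivity (- \sum_s wave s * wave (s / 2%:R)).
  rewrite -sumrN; apply: eq_bigr => s _.
  under eq_bigr => t _ do rewrite -mulrA.
  by rewrite -mulr_sumr pick sum_wave mulr0 sub0r mulrN.
rewrite (reindex_inj (mulIf F2)) /=.
have -> : \sum_s wave (s * 2%:R) * wave (s * 2%:R / 2%:R) = \sum_s wave s * wave (s *+ 2 - 0).
  by apply: eq_bigr => s _; rewrite mulfK // mulr_natr subr0 mulrC.
by rewrite pick sum_wave mulr0 sub0r opprK mul0r /wave eqxx.
Qed.

(** Along the direction [v] the [u] factors are constant, while the [wave] factors run over all
    progressions in [F]. *)
Lemma ap3_wave u xi v : 2%:R != 0 :> F -> dot xi v = 1 ->
  (forall x s, u (x + s *: v) = u x) ->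
  let g x := u x * wave (dot xi x) in
  q ^+ 2 * ap3 g g g = (q^-1 - 1) * ap3 u u u.
Proof.
move=> F2 xiv ui g; rewrite /ap3 (sum_avg2 v) mulr_sumr; apply: eq_bigr => x _.
rewrite mulr_sumr; apply: eq_bigr => y _; rewrite -(wave_progressions F2) mulr_suml.
rewrite [RHS](reindex_inj (addrI (dot xi x))); apply: eq_bigr => s _ /=.
rewrite mulr_suml [RHS](reindex_inj (addrI (dot xi y))); apply: eq_bigr => r _ /=.
have -> : (y + r *: v) *+ 2 - (x + s *: v) = y *+ 2 - x + (r *+ 2 - s) *: v.
  by rewrite mulrnDl opprD addrACA scalerBl scalerMnl.
have zE : dot xi (y *+ 2 - x + (r *+ 2 - s) *: v) =
    (dot xi y + r) *+ 2 - (dot xi x + s).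
  by rewrite dotD dotZ xiv dotD dotN dotMn; ring.
by rewrite /g !ui zE !dotD !dotZ xiv !mulr1; ring.
Qed.

(** For [r] in [0,1], this is both the amplitude by which [r] can move either way within [0,1] and
    its distance to {0,1}; hence it links perturbation with rounding. *)
Definition defect (r : R) := Num.min r (1 - r).

(** Both [f] and [f'] are the coset average plus a mean-zero part, so by [ap3_orthoD] the term
    [ap3 av av av] cancels in the difference. *)
Lemma perturbation W f : 2%:R != 0 :> F -> W != 0%VS -> (forall x, 0 <= f x <= 1) ->
  exists f', [/\ forall x, 0 <= f' x <= 1, \sum_x f' x = \sum_x f x &
    let u x := defect (coset_avg W f x) in
    let k x := f x - coset_avg W f x in
    q ^+ 2 * (ap3 f' f' f' - ap3 f f f) = (q^-1 - 1) * ap3 u u u - q ^+ 2 * ap3 k k k].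
Proof.
move=> F2 W0 f01; set av := coset_avg W f; pose u x := defect (av x).
pose k x := f x - av x.
have [v Wv v0] : exists2 v, v \in W & v != 0.
  by exists (vpick W); rewrite ?memv_pick ?vpick0.
have [xi xiv] := exists_dual1 v0.
have avi : coset_invariant W av := avg_inv f.
have av01 := avg_itv W f01.
have ui x s : u (x + s *: v) = u x by rewrite /u avi // rpredZ.
pose g x := u x * wave (dot xi x).
(* As [v] lies in [W], each coset splits into lines along [v], on which [u] is constant and [wave]
   sums to zero. *)
have gmz : mean_zero W g.
  have q0 : 0 < q := card_gt0.
  move=> x; apply: (mulfI (lt0r_neq0 q0)); rewrite mulr0.
  have -> : \sum_(w in W) g (x + w) = \sum_w (w \in W)%:R * g (x + w).
    by rewrite big_mkcond; apply: eq_bigr => w _; case: ifP; rewrite ?mul1r ?mul0r.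
  rewrite (sum_avg (fun s => s *: v)) big1 // => w _.
  under eq_bigr => s _ do rewrite rpredDr ?rpredZ // addrA /g ui dotD dotZ xiv mulr1 mulrA.
  rewrite -mulr_sumr (_ : \sum_s _ = 0) ?mulr0 //.
  by rewrite -[RHS]sum_wave [RHS](reindex_inj (addrI (dot xi (x + w)))).
exists (fun x => av x + g x); split.
- move=> x; have /andP[a0 a1] := av01 x.
  have : `|g x| <= u x.
    have u0 : 0 <= u x by rewrite /u /defect le_min a0 subr_ge0.
    by rewrite normrM (ger0_norm u0) ler_piMr ?wave_le1.
  rewrite {1}/u /defect le_min !ler_norml => /andP[/andP[? ?] /andP[? ?]].
  by apply/andP; split; lra.
- by rewrite big_split /= (sum_mean_zero1 gmz) addr0 sum_avg1.
- move=> /=; rewrite (ap3_orthoD F2 avi gmz).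
  have -> : ap3 f f f = ap3 av av av + ap3 k k k.
    rewrite -(ap3_orthoD F2 avi (mean_zero_sub_avg W f)).
    by apply: eq_bigr => x _; apply: eq_bigr => y _; rewrite /k ![av _ + _]addrC !subrK.
  have := ap3_wave F2 xiv ui; rewrite /= -/g => gE.
  by rewrite -[ap3 (fun x => defect _) _ _]/(ap3 u u u) -gE; ring.
Qed.

Lemma rounding W f : (forall x, 0 <= f x <= 1) ->
  exists h, [/\ forall x, h x = 0 \/ h x = 1, coset_invariant W h &
    \sum_x `|f x - h x| = \sum_x defect (coset_avg W f x)].
Proof.
move=> f01; pose h x : R := if 2^-1 <= coset_avg W f x then 1 else 0.
have hi : coset_invariant W h by move=> x w Ww; rewrite /h avg_inv.
exists h; split => //; first by move=> x; rewrite /h; case: ifP; [right|left].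
(* For [h] in {0,1} and [f] in [0,1], the distance is affine in [f] with [W]-invariant coefficients,
   so [f] may be replaced by its coset average. *)
transitivity (\sum_x f x * (1 - 2 * h x) + \sum_x h x).
  rewrite -big_split; apply: eq_bigr => x _ /=; rewrite /h; have /andP[f0 f1] := f01 x.
  case: ifP => _; last by rewrite subr0 ger0_norm //; ring.
  by rewrite distrC ger0_norm ?subr_ge0 //; ring.
rewrite -(sum_avgM (W := W)) => [|x w Ww]; last by rewrite hi.
rewrite -big_split; apply: eq_bigr => x _; rewrite /h /defect /=.
by case: leP => H; [rewrite min_r | rewrite min_l]; try lra.
Qed.

End Structure.

(** * Minimizers at a fixed accuracy *)

(** Competitors are compared with the mean of [f] itself rather than with a fixed density, so [K]
    depends only on [F] and [beta]. *)
Lemma minimizer_structure {R : realType} (F : finFieldType) (beta : R) :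
  2%:R != 0 :> F -> 0 < beta -> exists K : nat,
  forall (n : nat) (f : 'rV[F]_n -> R) (M : R := #|{: 'rV[F]_n}|%:R), (K < n)%N ->
    (forall x, 0 <= f x <= 1) ->
    (forall f' : 'rV[F]_n -> R, (forall x, 0 <= f' x <= 1) -> \sum_x f x <= \sum_x f' x ->
      ap3 f f f <= ap3 f' f' f') ->
    exists (W : {vspace 'rV[F]_n}) (h : 'rV[F]_n -> R),
      [/\ (n <= \dim W + K)%N, forall x, h x = 0 \/ h x = 1, coset_invariant W h &
          \sum_x `|f x - h x| <= beta * M].
Proof.
move=> F2 beta0; have [d d0 dP] := roth F2 beta0.
set q : R := #|F|%:R; have q0 : 0 < q := card_gt0; have q1 : 1 < q := card_gt1.
have i1 : 0 < 1 - q^-1 by rewrite subr_gt0 invf_lt1.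
(* With this [eta] the error [q^2 * eta * M^2] is exactly half of the gain [(1 - 1/q) * d * M^2]
   that [roth] guarantees. *)
pose eta := (1 - q^-1) * d / (2 * q ^+ 2).
have q20 : 0 < q ^+ 2 by rewrite exprn_gt0.
have eta0 : 0 < eta by rewrite divr_gt0 ?mulr_gt0.
exists (Num.bound ((q / eta) ^+ 2)) => n f M Kn f01 fmin.
have M0 : 0 < M := space_gt0.
have [W [K [dimW KE Hs]]] := regularity eta0 f01.
have KB : (K <= Num.bound ((q / eta) ^+ 2))%N.
  rewrite ltnW // -(ltr_nat R); apply: le_lt_trans KE _; apply: archi_boundP.
  exact: sqr_ge0.
(* The codimension of [W] is at most the bound on [K], which is less than [n]; this leaves a
   direction to perturb in. *)
have W0 : W != 0%VS.
  apply: contraTneq Kn => W0; move: dimW; rewrite W0 dimv0 add0n -leqNgt => nK.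
  exact: leq_trans nK KB.
have [h [h01 hi hE]] := rounding W f01.
exists W, h; split => //; first by apply: leq_trans dimW _; rewrite leq_add2l.
rewrite hE leNgt; apply/negP => /ltW uB.
pose u x := defect (coset_avg W f x).
have u01 x : 0 <= u x <= 1.
  have /andP[a0 a1] := avg_itv W f01 x.
  by rewrite /u /defect le_min a0 subr_ge0 a1 ge_min a1.
have uT := dP n u u01 uB.
have [f' [f'01 sf' Tf']] := perturbation F2 W0 f01.
have ff' : ap3 f f f <= ap3 f' f' f' by apply: fmin; rewrite ?sf'.
pose k x := f x - coset_avg W f x.
have kT : `|ap3 k k k| <= eta * M * M.
  apply: le_trans (ap3_le (sum_mean_zero1 (mean_zero_sub_avg W f)) Hs) _.
  rewrite -/q [q * _]mulrC divfK ?lt0r_neq0 // (ler_pM2l (mulr_gt0 eta0 M0)).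
  rewrite /M -sumr_const; apply: ler_sum => x _; rewrite -real_normK ?num_real //.
  rewrite exprn_ile1 // ler_norml.
  have /andP[? ?] := f01 x; have /andP[? ?] := avg_itv W f01 x.
  by apply/andP; split; lra.
move: Tf'; rewrite /= -/(u) -/(k) -/q => Tf'.
have : 0 <= q ^+ 2 * (ap3 f' f' f' - ap3 f f f) by rewrite mulr_ge0 ?subr_ge0 // ltW.
rewrite Tf'.
have : (1 - q^-1) * (d * M ^+ 2) <= (1 - q^-1) * ap3 u u u by rewrite ler_pM2l.
have : - (q ^+ 2 * ap3 k k k) <= q ^+ 2 * (eta * M * M).
  rewrite -mulrN ler_pM2l //; apply: le_trans kT.
  by rewrite -[leRHS]normrN ler_norm.
have -> : q ^+ 2 * (eta * M * M) = (1 - q^-1) * (d * M ^+ 2) / 2.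
  by rewrite /eta; field; rewrite lt0r_neq0.
have : 0 < (1 - q^-1) * (d * M ^+ 2) by rewrite !mulr_gt0 ?exprn_gt0.
rewrite -[ap3 (fun x => defect _) _ _]/(ap3 u u u) -[ap3 (fun x => f x - _) _ _]/(ap3 k k k).
lra.
Qed.

(** * Letting the accuracy improve with the dimension *)

Lemma diagonal_choice (Q : nat -> nat -> Prop) :
  (forall n, Q n 0%N) ->
  (forall k, exists N, forall n, (N <= n)%N -> Q n k) ->
  exists K : nat -> nat, (forall n, Q n (K n)) /\
    forall k, exists N, forall n, (N <= n)%N -> (k <= K n)%N.
Proof.
move=> Q0 /choice[N QN].
(* The best accuracy level up to [n] whose threshold has been passed; the empty maximum is 0, where
   [Q0] applies. *)
exists (fun n => \max_(k < n.+1 | (N k <= n)%N) k)%N; split=> [n|k].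
  elim/big_ind: _ => [//|i j Qi Qj|i /QN//].
  by rewrite /maxn; case: ifP.
exists (maxn k (N k)) => n; rewrite geq_max -ltnS => /andP[kn Nn].
exact: (@leq_bigmax_cond _ (fun i : 'I_n.+1 => N i <= n)%N _ (Ordinal kn)).
Qed.

Lemma cvg_inv_unbounded (R : realType) (K : nat -> nat) :
  (forall k, exists N, forall n, (N <= n)%N -> (k <= K n)%N) ->
  ((fun n => (K n).+1%:R^-1 : R) @ \oo --> (0 : R))%classic.
Proof.
move=> Koo; apply/cvgrPdist_le => e e0.
have [N NP] := Koo (Num.bound e^-1); exists N => // n /= /NP bK.
rewrite sub0r normrN ger0_norm ?invr_ge0 // -[leRHS]invrK lef_pV2 ?posrE ?invr_gt0 //.
apply: ltW; apply: lt_le_trans (archi_boundP _) _; first by rewrite invr_ge0 ltW.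
by rewrite ler_nat ltnW.
Qed.

Lemma Lambda3E (R : realType) (p n : nat) (f : Fpn p n -> R) :
  Lambda3 f = (p%:R ^+ (2 * n))^-1 * ap3 f f f.
Proof.
rewrite /Lambda3 /ap3; congr (_ * _); apply: eq_bigr => x _.
rewrite [RHS](reindex_inj (addrI x)); apply: eq_bigr => d _ /=.
congr (_ * f _); apply/eqP.
by rewrite eq_sym subr_eq addrAC -mulr2n -mulrnDl.
Qed.

Local Open Scope classical_set_scope.

Theorem theorem2 (R : realType) (p : nat) (alpha : R) :
  prime p -> odd p -> 0 < alpha <= 1 ->
  exists a c : nat -> R,
    a @ \oo --> (0 : R) /\ c @ \oo --> (0 : R) /\
    forall (n : nat) (f : 'rV['F_p]_n -> R),
      unit_valued f -> alpha <= Ex f ->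
      (forall f' : 'rV['F_p]_n -> R,
          unit_valued f' -> alpha <= Ex f' -> Lambda3 f <= Lambda3 f') ->
      exists (W : {vspace 'rV['F_p]_n}) (h : 'rV['F_p]_n -> R),
        n%:R - a n * n%:R <= (\dim W)%:R /\
        (forall x, h x = 0 \/ h x = 1) /\
        (forall x w, w \in W -> h (x + w) = h x) /\
        Ex (fun m => `|f m - h m|) <= c n.
Proof.
move=> pp podd /andP[alpha0 alpha1].
have cF : #|'F_p| = p by rewrite card_Fp.
have F2 : 2%:R != 0 :> 'F_p.
  rewrite -(dvdn_pcharf (pchar_Fp pp)); apply/negP => /(@dvdn_leq p 2 isT) p2.
  by have := prime_gt1 pp; move: podd p2; case: p {pp cF} => [|[|[|]]].
have p0 : 0 < p%:R :> R by rewrite ltr0n prime_gt0.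
have cV n : #|{: 'rV['F_p]_n}|%:R = p%:R ^+ n :> R.
  by rewrite card_mx cF mul1n natrX.
(* A single accuracy [1/(k + 1)] serves for both the codimension ratio and the error. *)
pose Q (n k : nat) := forall f : 'rV['F_p]_n -> R,
  unit_valued f -> alpha <= Ex f ->
  (forall f' : 'rV['F_p]_n -> R,
      unit_valued f' -> alpha <= Ex f' -> Lambda3 f <= Lambda3 f') ->
  exists (W : {vspace 'rV['F_p]_n}) (h : 'rV['F_p]_n -> R),
    n%:R - k.+1%:R^-1 * n%:R <= (\dim W)%:R :> R /\
    (forall x, h x = 0 \/ h x = 1) /\
    (forall x w, w \in W -> h (x + w) = h x) /\
    Ex (fun m => `|f m - h m|) <= k.+1%:R^-1.
have [n f f01 _ _|k|K [KQ Koo]] := @diagonal_choice Q.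
(* At accuracy 1 the zero subspace and [h = 0] suffice, since [f <= 1]. *)
- exists 0%VS, (fun=> 0); split; first by rewrite invr1 mul1r subrr.
  split; [by left | split => //].
  rewrite /Ex invr1 mulrC ler_pdivrMr ?exprn_gt0 // mul1r -cV -sumr_const.
  apply: ler_sum => x _; rewrite subr0.
  by have /andP[f0 f1] := f01 x; rewrite ger0_norm.
- have b0 : 0 < k.+1%:R^-1 :> R by rewrite invr_gt0.
  have [K KP] := minimizer_structure F2 b0.
  (* This threshold yields both [K < n] and [K <= n/(k + 1)]. *)
  exists (K.+1 * k.+1)%N => n Nn f f01 fa fmin.
  have Kn : (K < n)%N by apply: leq_trans Nn; rewrite leq_pmulr.
  have [f' f'01 sf|W [h [dimW h01 hi hE]]] := KP n f Kn f01.
    rewrite -(@ler_pM2l _ (p%:R ^+ (2 * n))^-1) ?invr_gt0 ?exprn_gt0 //.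
    rewrite -!Lambda3E; apply: fmin => //; apply: le_trans fa _.
    by rewrite /Ex ler_pM2l // invr_gt0 exprn_gt0.
  exists W, h; split; last split => //; last split => //.
    rewrite lerBlDr; apply: (@le_trans _ _ ((\dim W)%:R + K%:R)).
      by rewrite -natrD ler_nat.
    rewrite lerD2l mulrC ler_pdivlMr // -natrM ler_nat.
    by apply: leq_trans Nn; rewrite leq_mul2r leqnSn orbT.
  by rewrite /Ex mulrC ler_pdivrMr ?exprn_gt0 // -cV.
exists (fun n => (K n).+1%:R^-1), (fun n => (K n).+1%:R^-1).
by split; [|split] => [||n f]; [exact: cvg_inv_unbounded.. | exact: KQ].
Qed.
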